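(* For each integer $\sigma\ge 2$, $\mathit{SQ}'_{\mathrm{Abel}}(n,\sigma)=\Omega(n^{3/2})$.
   Context: For a word $w$ over the alphabet $\{0,\ldots,\sigma-1\}$, its Parikh vector is $P(w)=(|w|_0,\ldots,|w|_{\sigma-1})$, where $|w|_c$ counts occurrences of $c$. An Abelian square is a word $uv$ with $u,v$ nonempty, $|u|=|v|$ and $P(u)=P(v)$. Two Abelian squares are equivalent (in the Abelian sense) if they have the same Parikh vector. $\mathit{SQ}'_{\mathrm{Abel}}(n,\sigma)$ is the maximum, over all words $w$ of length $n$ over an alphabet of size $\sigma$, of the number of pairwise nonequivalent Abelian squares occurring as subwords (contiguous factors) of $w$. *)

(* Defs.v *)
From HB Require Import structures.
From mathcomp Require Import all_boot all_order all_algebra.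
From mathcomp Require Import boolp classical_sets reals topology normedtype.
From mathcomp Require Import landau exp.

Set Implicit Arguments.
Unset Strict Implicit.
Unset Printing Implicit Defensive.

Section AbelianSquares.
Variable sigma : nat.
Implicit Types u v s : seq 'I_sigma.

Definition parikh s : {ffun 'I_sigma -> nat} := [ffun c => count_mem c s].

Definition abelian_square s : Prop :=
  exists u v, [/\ s = u ++ v, u <> [::], v <> [::],
                  size u = size v & parikh u = parikh v].

Definition abelian_equiv : rel (seq 'I_sigma) :=
  [rel s t | parikh s == parikh t].

(* Factors of a word of length n have length at most n, so n.-bseq 'I_sigma   *)
(* is a finite type containing all of them.                                   *)
Definition abelian_square_factors n (w : n.-tuple 'I_sigma) :
    {set n.-bseq 'I_sigma} :=
  [set s : n.-bseq 'I_sigma | infix s w && `[< abelian_square s >]]%SET.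

(* The largest number of pairwise nonequivalent elements is the number of     *)
(* equivalence classes.                                                       *)
Definition nonequiv_abelian_squares n (w : n.-tuple 'I_sigma) : nat :=
  #|equivalence_partition (fun s t : n.-bseq 'I_sigma => abelian_equiv s t)
      (abelian_square_factors w)|.

End AbelianSquares.

Definition SQ'_Abel (n sigma : nat) : nat :=
  \max_(w : n.-tuple 'I_sigma) nonequiv_abelian_squares w.

(* Main.v *)
Require Import Defs.
From HB Require Import structures.
From mathcomp Require Import all_boot all_order all_algebra.
From mathcomp Require Import boolp classical_sets reals topology normedtype.
From mathcomp Require Import landau exp.
From mathcomp Require Import zify.

(** Let [m] be of order [sqrt n] and write [S x] for the number of ones among
    the first [x] letters of a binary word and [g x = S x - x / 2] for its
    excess.  Positions [i < j < k] with [j - i = k - j] delimit an Abelian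
    square iff [g i + g k = 2 g j].  The word has three parts of length of order
    [m ^ 2]: on the left [1^(2m) 0^(2m)] is repeated, so [g] is a triangle wave
    with values in [[0, m]]; in the middle [01] is repeated, so [g] vanishes at
    even positions; on the right every block of length [4m] of [01]-repetitions
    loses one [1], so [g] is, at even positions, a staircase with a step down
    after each period of the wave.  For every [h < m] and every half-length
    [2b] in a range of order [m ^ 2], shifting the step [g = - h] to the left by
    [4b] covers a full period of the wave, hence meets a point with [g = h]; the
    midpoint is in the middle part.  These squares have length [4b] and
    [2(b - h)] ones, so they are pairwise nonequivalent, and there are of order
    [m ^ 3] of them. *)

Import Order.TTheory GRing.Theory Num.Theory.
Import numFieldNormedType.Exports.
Local Open Scope ring_scope.
Local Open Scope classical_set_scope.

Section Words.
Local Open Scope nat_scope.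

(** Sending [t] to the class of [F t] embeds [T] into the set of classes. *)
Lemma leq_nonequiv_abelian_squares (sigma n : nat) (w : n.-tuple 'I_sigma)
    (T : finType) (F : T -> seq 'I_sigma) :
  (forall t, infix (F t) w) -> (forall t, abelian_square (F t)) ->
  (forall t t', parikh (F t) = parikh (F t') -> t = t') ->
  #|T| <= nonequiv_abelian_squares w.
Proof.
move=> Fw Fsq Finj.
have szF t : size (F t) <= n by rewrite -(size_tuple w) size_infix.
pose G t : n.-bseq 'I_sigma := Bseq (szF t).
have GD t : G t \in abelian_square_factors w.
  by rewrite inE /= Fw; apply/asboolP.
pose cls s := [set u in abelian_square_factors w |
                 abelian_equiv (s : n.-bseq 'I_sigma) u]%SET.
have clsG_inj : injective (fun t => cls (G t)).
  move=> t t' eq_cls.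
  have : G t' \in cls (G t') by rewrite finset.in_set GD /=; apply: eqxx.
  by rewrite -eq_cls finset.in_set => /andP[_ /eqP]; apply: Finj.
rewrite -(card_imset predT clsG_inj); apply/subset_leq_card/fintype.subsetP.
move=> _ /imsetP[t _ ->]; rewrite /equivalence_partition.
by apply/imsetP; exists (G t).
Qed.

Section WaveAndStaircase.
Variable m : nat.
Hypothesis m_gt0 : 0 < m.

Definition wave_stair (x : nat) : bool :=
  if x < 4 * m * (3 * m) then x %% (4 * m) < 2 * m
  else if x < 4 * m * (6 * m) then odd x
  else odd x && ~~ (4 * m %| x.+1).

Definition prefix_ones x := count wave_stair (iota 0 x).

Lemma prefix_onesD i l :
  prefix_ones (i + l) = prefix_ones i + count wave_stair (iota i l).
Proof. by rewrite /prefix_ones iotaD count_cat. Qed.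

Lemma prefix_onesSS x :
  prefix_ones x.+2 = prefix_ones x + wave_stair x + wave_stair x.+1.
Proof. by rewrite -addn2 prefix_onesD /= addn0 addnA. Qed.

(** Two letters [11] raise the excess by one and [00] lower it by one, so the excess at [2 * a] is
    the distance from [a] to the nearest multiple of [2 * m]. *)
Lemma prefix_ones_left a : a <= 2 * m * (3 * m) ->
  prefix_ones (2 * a) = a + minn (a %% (2 * m)) (2 * m - a %% (2 * m)).
Proof.
have m2_gt0 : 0 < 2 * m by rewrite muln_gt0.
elim: a => [|a IH] a_le; first by rewrite muln0 mod0n min0n.
have r_lt : a %% (2 * m) < 2 * m by rewrite ltn_mod.
rewrite mulnS add2n prefix_onesSS IH ?(ltnW a_le)//.
have -> : wave_stair (2 * a) = (a %% (2 * m) < m).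
  rewrite /wave_stair ifT; last by lia.
  by rewrite [4 * m](_ : _ = 2 * (2 * m)) -?muln_modr; lia.
have -> : wave_stair (2 * a).+1 = (a %% (2 * m) < m).
  rewrite /wave_stair ifT; last by lia.
  have -> : (2 * a).+1 %% (4 * m) = (2 * (a %% (2 * m))).+1.
    rewrite {1}(divn_eq a (2 * m)).
    have -> : (2 * (a %/ (2 * m) * (2 * m) + a %% (2 * m))).+1 =
       a %/ (2 * m) * (4 * m) + (2 * (a %% (2 * m))).+1 by nia.
    by rewrite modnMDl modn_small //; lia.
  lia.
have -> : a.+1 %% (2 * m) =
          if (a %% (2 * m)).+1 == 2 * m then 0 else (a %% (2 * m)).+1.
  rewrite {1}(divn_eq a (2 * m)) -addnS modnMDl.
  case: eqP => [->|neq]; first by rewrite modnn.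
  by rewrite modn_small //; lia.
case: eqP; case: (ltnP (a %% (2 * m)) m); lia.
Qed.

Lemma prefix_ones_middle a :
  2 * m * (3 * m) <= a <= 2 * m * (6 * m) -> prefix_ones (2 * a) = a.
Proof.
move=> /andP[]; elim: a => [|a IH] a_ge a_le; first by [].
(* The left part consists of [3 * m] full periods, so the wave is back at zero where the middle part
   begins. *)
move: a_ge; rewrite leq_eqVlt => /orP[/eqP<-|a_ge].
  by rewrite prefix_ones_left // modnMr min0n addn0.
rewrite mulnS add2n prefix_onesSS IH ?(ltnW a_le)//.
have waveE x : 2 * a <= x <= (2 * a).+1 -> wave_stair x = odd x.
  by rewrite /wave_stair => ?; rewrite ifF ?ifT //; lia.
rewrite !waveE; lia.
Qed.

(** Each of the [y %/ (2 * m)] complete blocks has lost a single one; the loss is added on the left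
    to avoid truncated subtraction. *)
Lemma prefix_ones_right y :
  prefix_ones (2 * (2 * m * (6 * m) + y)) + y %/ (2 * m) =
  2 * m * (6 * m) + y.
Proof.
elim: y => [|y IH]; first by rewrite addn0 div0n addn0 prefix_ones_middle; nia.
rewrite addnS mulnS add2n prefix_onesSS.
have -> : wave_stair (2 * (2 * m * (6 * m) + y)) = false.
  by rewrite /wave_stair !ifF; lia.
have -> : wave_stair (2 * (2 * m * (6 * m) + y)).+1 = ~~ (2 * m %| y.+1).
  rewrite /wave_stair !ifF; try lia.
  have -> : (2 * (2 * m * (6 * m) + y)).+2 = 2 * (2 * m * (6 * m) + y.+1).
    by lia.
  rewrite [4 * m](_ : _ = 2 * (2 * m)); last by lia.
  rewrite dvdn_pmul2l// dvdn_addr; first by lia.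
  exact: dvdn_mulr (dvdnn _).
rewrite divnS; lia.
Qed.

Lemma wave_stair_square b h : h < m -> 5 * (m * m) <= b < 6 * (m * m) ->
  exists a, [/\ 2 * a + 4 * b <= 28 * (m * m),
    count wave_stair (iota (2 * a) (2 * b)) = b - h &
    count wave_stair (iota (2 * a + 2 * b) (2 * b)) = b - h].
Proof.
move=> h_lt /andP[b_ge b_lt].
have m2_gt0 : 0 < 2 * m by rewrite muln_gt0.
(* The left end [2 * a] needs [a %% (2 * m) = h] for excess [h], and the right end must lie on step
   [h]; [r] is half its offset within that step. *)
pose e := (h + 2 * b) %/ (2 * m); pose r := (h + 2 * b) %% (2 * m).
have eE : h + 2 * b = e * (2 * m) + r := divn_eq _ _.
have r_lt : r < 2 * m by rewrite ltn_mod.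
have hm_le : h * m + m <= m * m by rewrite -mulSnr leq_mul2r h_lt orbT.
(* This keeps the subtraction in the definition of [a] exact. *)
have e_le : e <= 6 * m.
  rewrite leqNgt; apply/negP => e_gt.
  have : (6 * m).+1 * m <= e * m by rewrite leq_mul2r e_gt orbT.
  lia.
pose a := (6 * m + h - e) * (2 * m) + h.
have aE : a + e * (2 * m) = (6 * m + h) * (2 * m) + h.
  by rewrite /a addnAC -mulnDl subnK//; lia.
have a_mod : a %% (2 * m) = h by rewrite modnMDl modn_small; lia.
have yE : a + 2 * b = 2 * m * (6 * m) + (h * (2 * m) + r) by lia.
(* The excesses at the left end, the midpoint and the right end are [h], [0] and [- h], so each half
   has [b - h] ones. *)
have Sa : prefix_ones (2 * a) = a + h.
  rewrite prefix_ones_left ?a_mod; lia.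
have Sab : prefix_ones (2 * a + 2 * b) = a + b.
  rewrite -mulnDr prefix_ones_middle//; apply/andP; split; lia.
have Sabb : prefix_ones (2 * a + 2 * b + 2 * b) + h = a + 2 * b.
  rewrite -addnA -mulnDr addnn -mul2n -mulnDr yE -[in RHS]prefix_ones_right.
  by rewrite divnMDl// (divn_small r_lt) addn0.
have := prefix_onesD (2 * a) (2 * b).
have := prefix_onesD (2 * a + 2 * b) (2 * b).
exists a; split; lia.
Qed.

End WaveAndStaircase.

Section TwoLetterWords.
Variables (sigma : nat) (c0 c1 : 'I_sigma) (f : nat -> bool).
Hypothesis c01 : c0 != c1.

Definition letter x := if f x then c1 else c0.

(** On words in [c0] and [c1], the Parikh vector amounts to the length and the number of ones,
    whatever the size of the alphabet. *)
Lemma parikh_letter s :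
  parikh (map letter s) =
  [ffun c => if c == c1 then count f s
             else if c == c0 then size s - count f s else 0].
Proof.
apply/ffunP => c; rewrite !ffunE count_map.
case: eqVneq => [->|c_neq1].
  apply: eq_count => x /=; rewrite /letter.
  by case: (f x); rewrite ?eqxx// (negbTE c01).
case: eqVneq => [->|c_neq0].
  rewrite -(count_predC f s) addKn; apply: eq_count => x /=.
  by rewrite /letter; case: (f x); rewrite ?eqxx// eq_sym (negbTE c01).
rewrite -(count_pred0 s); apply: eq_count => x /=.
by rewrite /letter; case: (f x); rewrite eq_sym; apply/negbTE.
Qed.

End TwoLetterWords.

Lemma infix_map_iota (T : eqType) (g : nat -> T) i l n :
  i + l <= n -> infix (map g (iota i l)) (map g (iota 0 n)).
Proof.
move=> il_le; apply/infixP.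
exists (map g (iota 0 i)), (map g (iota (i + l) (n - (i + l)))).
rewrite -!map_cat -iotaD -[X in iota 0 X ++ _]/(0 + i) -iotaD.
by congr map; congr iota; lia.
Qed.

(** There are [m * m] values of [b] and [m] values of [h]. The constant 28 covers the left and
    middle parts, of total length [24 * (m * m)], and [m] steps of length [4 * m]. *)
Lemma leq_SQ'_Abel sigma m n : 2 <= sigma -> 0 < m -> 28 * (m * m) <= n ->
  m * m * m <= SQ'_Abel n sigma.
Proof.
move=> sigma_ge2 m_gt0 n_ge.
pose c0 : 'I_sigma := Ordinal (ltnW sigma_ge2).
pose c1 : 'I_sigma := Ordinal sigma_ge2.
have c01 : c0 != c1 by [].
pose g := letter sigma c0 c1 (wave_stair m).
have sz_w : size (map g (iota 0 n)) == n by rewrite size_map size_iota.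
pose w : n.-tuple 'I_sigma := Tuple sz_w.
pose b (t : 'I_(m * m) * 'I_m) := 5 * (m * m) + t.1.
have /choice[a aP] (t : 'I_(m * m) * 'I_m) : exists a,
    [/\ 2 * a + 4 * b t <= 28 * (m * m),
    count (wave_stair m) (iota (2 * a) (2 * b t)) = b t - t.2 &
    count (wave_stair m) (iota (2 * a + 2 * b t) (2 * b t)) = b t - t.2].
  by apply: wave_stair_square => //; rewrite /b; case: t => -[t /= ?] h /=; lia.
pose F t := map g (iota (2 * a t) (2 * b t + 2 * b t)).
have F1 t : infix (F t) w.
  by apply: infix_map_iota; have [] := aP t; lia.
have b_gt0 t : 0 < b t by rewrite /b; nia.
have F2 t : abelian_square (F t).
  exists (map g (iota (2 * a t) (2 * b t))),
    (map g (iota (2 * a t + 2 * b t) (2 * b t))).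
  have [_ cl cr] := aP t; split.
  - by rewrite -map_cat -iotaD.
  - by move=> /(congr1 size); rewrite size_map size_iota /=;
      have := b_gt0 t; lia.
  - by move=> /(congr1 size); rewrite size_map size_iota /=;
      have := b_gt0 t; lia.
  - by rewrite !size_map !size_iota.
  - by rewrite !parikh_letter// cl cr !size_iota.
have cntF t : count (wave_stair m) (iota (2 * a t) (2 * b t + 2 * b t)) =
              b t - t.2 + (b t - t.2).
  by rewrite iotaD count_cat; have [_ -> ->] := aP t.
have F3 t t' : parikh (F t) = parikh (F t') -> t = t'.
  rewrite /F !parikh_letter// => /ffunP eqF.
  have := eqF c0; have := eqF c1; rewrite !ffunE !eqxx (negbTE c01).
  rewrite !cntF !size_iota.
  (* This gives [h <= b], so no subtraction truncates: the two counts add up to the length [4 * b],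
     which gives [b], and the ones then give [h]. *)
  have m_le : m <= m * m by rewrite leq_pmulr.
  rewrite /b; case: t t' {eqF} => [t h] [t' h'] /= ? ?.
  have h_lt := ltn_ord h; have h'_lt := ltn_ord h'.
  by congr (_, _); apply: val_inj => /=; lia.
have := leq_nonequiv_abelian_squares _ _ _ _ _ F1 F2 F3.
rewrite card_prod !card_ord => /leq_trans; apply.
exact: (leq_bigmax w).
Qed.

(** For the largest [m] with [28 * (m * m) <= n], one has [n < 28 * (m.+1 * m.+1) <= 112 * (m * m)],
    and 112 is below the square of 11. *)
Lemma sqrt_scale n : 28 <= n ->
  exists m, [/\ 0 < m, 28 * (m * m) <= n & n <= 11 * m * (11 * m)].
Proof.
elim: n => // n IH; rewrite leq_eqVlt => /orP[/eqP<-|/IH[m [m_gt0 lo hi]]].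
  by exists 1.
have [n_lt|n_ge] := ltnP n.+1 (28 * (m.+1 * m.+1)); last first.
  by exists m.+1; split=> //; nia.
by exists m; split=> //; nia.
Qed.

End Words.

Theorem theorem8 (R : realType) (sigma : nat) (sigma_ge2 : (2 <= sigma)%N) :
  (fun n : nat => (SQ'_Abel n sigma)%:R : R^o)
    \is 'Omega_\oo (fun n : nat => n%:R `^ (3 / 2) : R^o).
Proof.
(* The constant comes from bounding the power of [n] by [(11 * m) ^ 3], while there are at least
   [m ^ 3] classes. *)
rewrite qualifE; apply/asboolP; exists (11 ^+ 3)^-1.
  by rewrite invr_gt0 exprn_gt0.
exists 28%N => // n /= n_ge.
have [m [m_gt0 lo hi]] := @sqrt_scale n n_ge.
rewrite !ger0_norm ?powR_ge0// ler_pdivrMl ?exprn_gt0//.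
have le_pow : n%:R `^ (3 / 2) <= (11 * m)%:R ^+ 3 :> R.
  have -> : (11 * m)%:R ^+ 3 = ((11 * m)%:R ^+ 2) `^ (3 / 2) :> R.
    rewrite -[in RHS]powR_mulrn// -powRrM [2 * _]mulrC.
    by rewrite divfK ?pnatr_eq0// powR_mulrn.
  apply: ge0_ler_powR; rewrite ?nnegrE ?exprn_ge0 ?divr_ge0//.
  by rewrite -natrX ler_nat expnS expn1.
apply: (le_trans le_pow); rewrite natrM exprMn ler_pM2l ?exprn_gt0//.
by rewrite -natrX ler_nat 2!expnSr expn1; exact: leq_SQ'_Abel.
Qed.
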